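(* Let $r \in [30, \infty)$. Then the self-similar set $C^r \subset \mathbb{R}^2$ is not Minkowski measurable.
   Context: For a real number $r>2$ let $S^r_1,S^r_2,S^r_3,S^r_4:\mathbb{R}^2\to\mathbb{R}^2$ be the similarities $$S^r_1(x)=\tfrac{1}{r}x,\quad S^r_2(x)=\tfrac{1}{r}x+\begin{pmatrix}\frac{r-1}{r}\\0\end{pmatrix},\quad S^r_3(x)=\tfrac{1}{r}x+\begin{pmatrix}\frac{r-1}{r}\\\frac{r-1}{r}\end{pmatrix},\quad S^r_4(x)=\tfrac{1}{r}x+\begin{pmatrix}0\\\frac{r-1}{r}\end{pmatrix}.$$ $C^r$ denotes the self-similar attractor of $\{S^r_1,S^r_2,S^r_3,S^r_4\}$, i.e. the unique non-empty compact set $C^r\subset\mathbb{R}^2$ with $C^r=\bigcup_{i=1}^4 S^r_i(C^r)$. For a non-empty compact set $A\subset\mathbb{R}^d$ (Euclidean norm $\|\cdot\|$) and $\varepsilon>0$, the $\varepsilon$-parallel set is $A_\varepsilon:=\{x\in\mathbb{R}^d \mid \min_{a\in A}\|x-a\|\le\varepsilon\}$, and $\lambda^d$ is $d$-dimensional Lebesgue measure. If the Minkowski dimension $$\dim_{\mathcal{M}}(A):=d-\lim_{\varepsilon\searrow 0}\frac{\ln\lambda^d(A_\varepsilon)}{\ln\varepsilon}$$ exists, the Minkowski content of $A$ is $$\mathcal{M}(A):=\lim_{\varepsilon\searrow 0}\frac{\lambda^d(A_\varepsilon)}{\varepsilon^{d-\dim_{\mathcal{M}}(A)}}.$$ $A$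 is called Minkowski measurable if $\mathcal{M}(A)$ exists and is both positive and finite. (The Minkowski dimension of $C^r$ exists and equals $D_r=\frac{\ln 4}{\ln r}$.) *)

(* Defs.v *)
From HB Require Import structures.
From mathcomp Require Import all_boot all_order all_algebra.
From mathcomp Require Import all_classical all_reals all_analysis.

Set Implicit Arguments.
Unset Strict Implicit.
Unset Printing Implicit Defensive.

Import Order.TTheory GRing.Theory Num.Theory.
Import numFieldNormedType.Exports.

Local Open Scope classical_set_scope.
Local Open Scope ring_scope.

Definition attractor (T : topologicalType) (I : finType) (S : I -> T -> T)
    (C : set T) : Prop :=
  [/\ C !=set0, compact C & C = \bigcup_(i in [set: I]) (S i @` C)].

Section Plane.
Context {R : realType}.
Implicit Types (A : set (R * R)) (p : R * R) (eps D : R) (M : \bar R).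

(* The fixed points of S^r_1, ..., S^r_4 are the corners of the unit square:
   S^r_i(x) = x / r + ((r - 1) / r) * corner_i.  Indices start at 0. *)
Definition corner (i : 'I_4) : R * R :=
  nth (0, 0) [:: (0, 0); (1, 0); (1, 1); (0, 1)] i.

Definition simil (r : R) (i : 'I_4) p : R * R :=
  (r^-1 * p.1 + (r - 1) / r * (corner i).1,
   r^-1 * p.2 + (r - 1) / r * (corner i).2).

(* The library norm on R * R is the sup norm, hence this explicit one. *)
Definition enorm p : R := Num.sqrt (p.1 ^+ 2 + p.2 ^+ 2).

(* For a non-empty compact set A the infimum is a minimum. *)
Definition parallel_set A eps : set (R * R) :=
  [set x | inf [set enorm (x - a) | a in A] <= eps].

Definition lebesgue2 : set (R * R) -> \bar R :=
  (@lebesgue_measure R \x @lebesgue_measure R)%E.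

(* [fine] loses nothing when A is bounded: the measure is then finite. *)
Definition parallel_volume A eps : R := fine (lebesgue2 (parallel_set A eps)).

Definition minkowski_dim A D : Prop :=
  ln (parallel_volume A eps) / ln eps @[eps --> 0^'+] --> 2 - D.

Definition minkowski_content A M : Prop :=
  exists2 D, minkowski_dim A D &
    (parallel_volume A eps / eps `^ (2 - D))%:E @[eps --> 0^'+] --> M.

Definition minkowski_measurable A : Prop :=
  exists2 M, minkowski_content A M & (0 < M < +oo)%E.

End Plane.

(* Main.v *)
Require Import Defs.
From mathcomp Require Import all_boot all_order all_algebra.
From mathcomp Require Import all_classical all_reals all_analysis.
From mathcomp Require Import measurable_realfun ring lra.

Set Implicit Arguments.
Unset Strict Implicit.
Unset Printing Implicit Defensive.

Import Order.TTheory GRing.Theory Num.Theory.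
Import numFieldNormedType.Exports.

Local Open Scope classical_set_scope.
Local Open Scope ring_scope.

(** Write V(e) for the area of the closed e-neighbourhood of C.

The set C lies in the unit square, so its four similar copies are at mutual
distance at least 1 - 2/r, and for e < (1 - 2/r)/2 their e-neighbourhoods are
disjoint. Each of these is an r-fold reduction of the (r e)-neighbourhood of C,
whence V(e) = (4 / r^2) V(r e) ([parallel_volume_scale]).

If V(e) / e^p has a nonzero limit M at 0, then along x, x/r, x/r^2, ... this
quotient is a convergent geometric sequence with nonzero limit, hence constant:
r^p = r^2 / 4 and V(x) = M x^p holds exactly, not only asymptotically, for all
0 < x < r/2 - 1 ([power_law_of_scaling]). When r >= 30 this range contains both
2 and 2 sqrt r, and multiplying x by sqrt r multiplies x^p by r/2, so
V(2 sqrt r) = (r/2) V(2).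

Discs refute this equality. The neighbourhood of radius 2 sqrt r contains a disc
of that radius, so V(2 sqrt r) >= 4 r u, where u is the area of the unit disc.
The set C lies in a disc of radius 3/4, so V(2) <= (11/4)^2 u. Since
(11/4)^2 / 2 < 4, these bounds are incompatible. The area u enters
only as a common factor, positive and finite. *)

(** * The Euclidean norm and parallel sets *)

Section EuclideanPlane.
Context {R : realType}.
Implicit Types (A B : set (R * R)) (p q x y a c : R * R) (s e d rho : R).

Lemma enorm_ge0 p : 0 <= enorm p.
Proof. exact: sqrtr_ge0. Qed.

Lemma sqr_enorm p : enorm p ^+ 2 = p.1 ^+ 2 + p.2 ^+ 2.
Proof. by rewrite sqr_sqrtr// addr_ge0// sqr_ge0. Qed.

Lemma enorm_le p e : 0 <= e -> (enorm p <= e) = (p.1 ^+ 2 + p.2 ^+ 2 <= e ^+ 2).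
Proof. by move=> e0; rewrite -sqr_enorm ler_pXn2r ?nnegrE ?enorm_ge0. Qed.

Lemma enormD p q : enorm (p + q) <= enorm p + enorm q.
Proof.
rewrite enorm_le ?addr_ge0 ?enorm_ge0// [leRHS]sqrrD !sqr_enorm /=.
suff : p.1 * q.1 + p.2 * q.2 <= enorm p * enorm q by nra.
rewrite (le_trans (ler_norm _))// -(@ler_pXn2r _ 2)//.
- rewrite real_normK ?num_real// exprMn !sqr_enorm.
  have := sqr_ge0 (p.1 * q.2 - p.2 * q.1); nra.
- by rewrite nnegrE mulr_ge0 ?enorm_ge0.
Qed.

Lemma enormN p : enorm (- p) = enorm p.
Proof. by rewrite /enorm /= !sqrrN. Qed.

Lemma enorm_triangle a p q : enorm (p - q) <= enorm (p - a) + enorm (a - q).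
Proof. by rewrite (le_trans _ (enormD _ _))// addrA subrK. Qed.

Lemma enorm_homothety s p q : 0 <= s ->
  p.1 = s * q.1 -> p.2 = s * q.2 -> enorm p = s * enorm q.
Proof.
move=> s0 p1 p2; rewrite /enorm p1 p2 !exprMn -mulrDr sqrtrM ?sqr_ge0//.
by rewrite sqrtr_sqr ger0_norm.
Qed.

Lemma coord1_le_enorm p : `|p.1| <= enorm p.
Proof. by rewrite -sqrtr_sqr ler_sqrt ?lerDl ?addr_ge0 ?sqr_ge0. Qed.

Lemma coord2_le_enorm p : `|p.2| <= enorm p.
Proof. by rewrite -sqrtr_sqr ler_sqrt ?lerDr ?addr_ge0 ?sqr_ge0. Qed.

(** The strict inequalities free the arguments below from the question whether
the infimal distance to [A] is attained. *)
Lemma parallel_setP A e x : A !=set0 ->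
  parallel_set A e x <->
  forall d, e < d -> exists2 a, A a & enorm (x - a) < d.
Proof.
move=> A0; split=> [xA d ed|xA].
  have [||_ [a Aa <-] xad] := @inf_lt _ [set enorm (x - a) | a in A] d.
  - exact: image_nonempty.
  - exact: le_lt_trans ed.
  - by exists a.
apply/ler_addgt0Pr => d d0.
have [|a Aa /ltW xad] := xA (e + d); first by rewrite ltrDl.
apply: le_trans xad; apply: ge_inf; last by exists a.
by exists 0 => _ [b _ <-]; exact: enorm_ge0.
Qed.

Definition disc c rho : set (R * R) := [set x | enorm (x - c) <= rho].

Lemma disc_sub_parallel A a e : A a -> disc a e `<=` parallel_set A e.
Proof.
move=> Aa x xa; apply/parallel_setP; first by exists a.
by move=> d; exists a => //; exact: le_lt_trans xa _.
Qed.

Lemma parallel_sub_disc A c rho e : A !=set0 ->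
  A `<=` disc c rho -> parallel_set A e `<=` disc c (rho + e).
Proof.
move=> A0 Ac x /parallel_setP -/(_ A0) xA.
apply/ler_addgt0Pr => d d0.
have [|a /Ac ac xa] := xA (e + d); first by rewrite ltrDl.
apply: (le_trans (enorm_triangle a _ _)).
rewrite addrC -addrA; apply: lerD => //; exact: ltW.
Qed.

(** The distance to a finite union is the distance to one of the pieces; the proof
takes the smallest of the margins by which the pieces would all fail. *)
Lemma parallel_set_bigcup (I : finType) (i0 : I) (F : I -> set (R * R)) e :
  (forall i, F i !=set0) ->
  parallel_set (\bigcup_(i in [set: I]) F i) e `<=`
  \bigcup_(i in [set: I]) parallel_set (F i) e.
Proof.
move=> F0 x; apply: contraPP => xF.
have /choice[d dP] : forall i, exists d,
    e < d /\ forall a, F i a -> d <= enorm (x - a).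
  move=> i.
  apply: contrapT => /forallNP xFi; apply: xF; exists i => //.
  apply/parallel_setP => // d ed; apply: contrapT => /forall2NP xd.
  apply: (xFi d); split=> // a Fa; rewrite leNgt; apply/negP => xad.
  by case: (xd a).
move=> xUF; pose m := \big[Order.min/(e + 1)]_i d i.
(* the default e + 1 also exceeds e, so the minimum stays above e *)
have em : e < m.
  by rewrite /m; elim/big_ind: _ => [|u v|i _]; rewrite ?ltrDl// ?lt_min;
    [move=> -> -> | case: (dP i)].
have UF0 : \bigcup_(i in [set: I]) F i !=set0.
  by have [a Fa] := F0 i0; exists a, i0.
have /parallel_setP -/(_ UF0) /(_ _ em) [a [i _ Fia]] := xUF.
apply/negP; rewrite -leNgt (le_trans _ ((dP i).2 _ Fia))//.
by rewrite /m (bigD1 i)//= ge_min lexx.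
Qed.

End EuclideanPlane.

(** * Lebesgue measure on the plane *)

Section PlanarLebesgue.
Context {R : realType}.
Implicit Types (A B : set (R * R)) (p q x y a c t : R * R) (s e d rho : R).

Local Notation mR := (measurableTypeR R).
Local Notation plane := (mR * mR)%type.
Local Notation lambda := (@lebesgue_measure R).

(** The product sigma-algebra contains the open sets of the plane because each of
them is a union of the countably many boxes with rational centre and radii that
it contains. *)
Lemma open_measurable_plane (U : set (R * R)) :
  open U -> measurable (U : set plane).
Proof.
move=> oU.
pose box (q : (rat * rat) * (rat * rat)) : set plane :=
  ball (ratr q.1.1 : R) (ratr q.1.2) `*` ball (ratr q.2.1 : R) (ratr q.2.2).
pose D := [set q | box q `<=` U].
suff -> : U = \bigcup_q (if q \in D then box q else set0).
  apply: countable_bigcupT_measurable => [|q]; first exact: countableP.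
  case: ifPn => // _.
  by apply: measurableX; apply: open_measurable; exact: ball_open.
apply/seteqP; split=> [[x y] Uxy|xy [q _]]; last first.
  by case: ifPn => // /set_mem; apply.
have /= [[A B] [/= Ax By] ABU] : nbhs (x, y) U by exact: open_nbhs_nbhs.
have [c1 [r1 [/set_mem x1 A1]]] : exists z w,
    let B : set R := ball (@ratr R z) (ratr w) in x \in B /\ B `<=` A°.
  apply: open_subball_rat; first exact: open_interior.
  exact/mem_set.
have [c2 [r2 [/set_mem y2 B2]]] : exists z w,
    let B' : set R := ball (@ratr R z) (ratr w) in y \in B' /\ B' `<=` B°.
  apply: open_subball_rat; first exact: open_interior.
  exact/mem_set.
exists ((c1, r1), (c2, r2)) => //; rewrite mem_set; first by split.
move=> [x' y'] [/= /A1 /interior_subset Ax' /B2 /interior_subset By'].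
exact: ABU.
Qed.

Lemma closed_measurable_plane A : closed A -> measurable (A : set plane).
Proof.
by move=> /closed_openC /open_measurable_plane /measurableC; rewrite setCK.
Qed.

Lemma closed_parallel_set A e : A !=set0 -> closed (parallel_set A e).
Proof.
move=> A0; rewrite -openC openE => x.
move=> /(contra_not (parallel_setP e x A0).2) /existsNP[d /not_implyP[ed xd]].
have d4 : 0 < (d - e) / 4 by lra.
exists ((ball x.1 ((d - e) / 4)), (ball x.2 ((d - e) / 4))).
  by split; exact: nbhsx_ballx.
move=> y [/= xy1 xy2] /parallel_setP -/(_ A0 ((d + e) / 2)).
case => [|a Aa ya]; first lra.
apply: xd; exists a => //.
rewrite (le_lt_trans (enorm_triangle y _ _))//.
suff xy : enorm (x - y) <= (d - e) / 2 by lra.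
move: xy1 xy2; rewrite /ball/= => /ltr_normlP[? ?] /ltr_normlP[? ?].
rewrite enorm_le; last lra.
by rewrite /=; nra.
Qed.

Lemma measurable_parallel_set A e : A !=set0 ->
  measurable (parallel_set A e : set plane).
Proof.
by move=> A0; apply: closed_measurable_plane; exact: closed_parallel_set.
Qed.

(** Discs inherit measurability from parallel sets. *)
Lemma disc_parallel_set c rho : disc c rho = parallel_set [set c] rho.
Proof.
by apply/seteqP; split=> x; rewrite /parallel_set/= image_set1 inf1.
Qed.

Lemma measurable_disc c rho : measurable (disc c rho : set plane).
Proof.
by rewrite disc_parallel_set; apply: measurable_parallel_set; exists c.
Qed.

Definition affine1 s b : mR -> mR := fun u => s * u + b.

Lemma measurable_affine1 s b : measurable_fun [set: mR] (affine1 s b).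
Proof.
by apply: measurable_funD => //; exact: measurable_funM.
Qed.

(** Pulling back along the affine map and then rescaling is a measure; it agrees
with Lebesgue measure on half-open intervals, hence everywhere. *)
Lemma lebesgue_measure_preimage_affine s b (X : set mR) : 0 < s ->
  measurable X ->
  lambda (affine1 s b @^-1` X) = (s^-1%:E * lambda X)%E.
Proof.
move=> s0 mX; have mf := @measurable_affine1 s b.
(* the pushforward is a measure only by virtue of mf, so the instance is
   named explicitly to record that proof *)
pose m : {measure set mR -> \bar R} :=
  measure_function_pushforward__canonical__measure_function_Measure lambda mf.
have -> : lambda X = mscale (NngNum (ltW s0)) m X.
  apply: lebesgue_measure_unique => // _ [[u v] _ <-] /=.
  change (lambda `]u, v] = s%:E * lambda (affine1 s b @^-1` `]u, v]))%E.
  have -> : affine1 s b @^-1` `]u, v] = `](u - b) / s, (v - b) / s]%classic.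
    apply/seteqP; split=> x; rewrite /affine1 /= !in_itv /=;
      by rewrite ltr_pdivrMr// ler_pdivlMr// ltrBlDr lerBrDr mulrC.
  rewrite !lebesgue_measure_itv /= !lte_fin ltr_pM2r ?invr_gt0// ltrD2r.
  case: ifPn => _; last by rewrite mule0.
  by rewrite -!EFinB -EFinM; congr EFin; field; rewrite gt_eqF.
change (lambda (affine1 s b @^-1` X) =
  s^-1%:E * (s%:E * lambda (affine1 s b @^-1` X)))%E.
by rewrite muleA -EFinM mulVf ?gt_eqF// mul1e.
Qed.

Lemma lebesgue2_rectangle (X Y : set mR) : measurable X -> measurable Y ->
  lebesgue2 (X `*` Y) = (lambda X * lambda Y)%E.
Proof. exact: product_measure1E. Qed.

Definition affine s t : R * R -> R * R :=
  fun x => (s * x.1 + t.1, s * x.2 + t.2).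

Lemma measurable_fun_affine s t :
  measurable_fun [set: plane] (affine s t : plane -> plane).
Proof.
apply: measurable_fun_pair.
  apply: (measurableT_comp (measurable_affine1 s t.1)).
  exact: measurable_fst.
apply: (measurableT_comp (measurable_affine1 s t.2)).
exact: measurable_snd.
Qed.

(** As on the line, with rectangles in place of intervals: a measure that agrees
with the product measure on rectangles equals it. *)
Lemma lebesgue2_preimage_affine s t (X : set plane) : 0 < s ->
  measurable X ->
  lebesgue2 (affine s t @^-1` X) = ((s ^- 2)%:E * lebesgue2 X)%E.
Proof.
move=> s0 mX; have mf := @measurable_fun_affine s t.
pose mu : {measure set plane -> \bar R} := (lambda \x lambda)%E.
pose m : {measure set plane -> \bar R} :=
  measure_function_pushforward__canonical__measure_function_Measure mu mf.
have s2 : 0 <= s ^+ 2 by rewrite sqr_ge0.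
have -> : lebesgue2 X = mscale (NngNum s2) m X.
  apply: product_measure_unique => // A B mA mB.
  change ((s ^+ 2)%:E * lebesgue2 (affine s t @^-1` (A `*` B)) =
    lambda A * lambda B)%E.
  have -> : affine s t @^-1` (A `*` B) =
     (affine1 s t.1 @^-1` A) `*`
     (affine1 s t.2 @^-1` B) by [].
  have mpre b (Y : set mR) : measurable Y ->
      measurable (affine1 s b @^-1` Y).
    by move=> mY; rewrite -[X in measurable X]setTI; exact: measurable_affine1.
  rewrite lebesgue2_rectangle//; [|exact: mpre..].
  rewrite !lebesgue_measure_preimage_affine// muleACA -EFinM -invfM -expr2.
  by rewrite [LHS]muleA -EFinM mulfV ?mul1e// expf_neq0// gt_eqF.
change (lebesgue2 (affine s t @^-1` X) =
  (s ^- 2)%:E * ((s ^+ 2)%:E * lebesgue2 (affine s t @^-1` X)))%E.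
by rewrite muleA -EFinM mulVf ?mul1e// expf_neq0// gt_eqF.
Qed.

Lemma le_lebesgue2 A B :
  measurable (A : set plane) -> measurable (B : set plane) ->
  A `<=` B -> (lebesgue2 A <= lebesgue2 B)%E.
Proof. by move=> mA mB AB; apply: le_measure => //; rewrite inE. Qed.

Definition unit_disc : set (R * R) := disc 0 1.

Lemma lebesgue2_disc c rho : 0 < rho ->
  lebesgue2 (disc c rho) = ((rho ^+ 2)%:E * lebesgue2 unit_disc)%E.
Proof.
move=> rho0.
pose T := affine rho^-1 (- (rho^-1 * c.1), - (rho^-1 * c.2)).
have -> : disc c rho = T @^-1` unit_disc.
  have TE x : enorm (T x - 0) = rho^-1 * enorm (x - c).
    by apply: enorm_homothety; rewrite ?invr_ge0 ?(ltW rho0)//= subr0 mulrBr.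
  apply/seteqP; split=> x; rewrite /unit_disc/disc/= TE mulrC;
    by rewrite ler_pdivrMr// mul1r.
rewrite lebesgue2_preimage_affine ?invr_gt0//; last exact: measurable_disc.
by rewrite exprVn invrK.
Qed.

Lemma lebesgue2_unit_disc_gt0 : (0 < lebesgue2 unit_disc)%E.
Proof.
pose Q : set plane := `[0, 1/2]%classic `*` `[0, 1/2]%classic.
have mQ : measurable Q by apply: measurableX.
apply: (@lt_le_trans _ _ (lebesgue2 Q)).
  rewrite lebesgue2_rectangle// !lebesgue_measure_itv /= lte_fin.
  by rewrite ifT; [rewrite -!EFinB -EFinM lte_fin; lra|lra].
apply: le_lebesgue2 => //; first exact: measurable_disc.
move=> x [/=]; rewrite !in_itv /= => /andP[? ?] /andP[? ?].
by rewrite /unit_disc/disc/= subr0 enorm_le//; nra.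
Qed.

Lemma lebesgue2_unit_disc_lty : (lebesgue2 unit_disc < +oo)%E.
Proof.
pose Q : set plane := `[-1, 1]%classic `*` `[-1, 1]%classic.
have mQ : measurable Q by apply: measurableX.
apply: (@le_lt_trans _ _ (lebesgue2 Q)).
  apply: le_lebesgue2 => //; first exact: measurable_disc.
  move=> x; rewrite /unit_disc/disc/= subr0 => x1.
  split; rewrite /= in_itv /= -ler_norml.
  - exact: le_trans (coord1_le_enorm _) x1.
  - exact: le_trans (coord2_le_enorm _) x1.
rewrite lebesgue2_rectangle// !lebesgue_measure_itv /= lte_fin.
by rewrite ifT; [rewrite -!EFinB -EFinM ltry|lra].
Qed.

Lemma fine_lebesgue2_disc c rho : 0 < rho ->
  lebesgue2 (disc c rho) = (rho ^+ 2 * fine (lebesgue2 unit_disc))%:E.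
Proof.
move=> rho0; rewrite lebesgue2_disc// [RHS]EFinM fineK//.
rewrite ge0_fin_numE; first exact: lebesgue2_unit_disc_lty.
exact/ltW/lebesgue2_unit_disc_gt0.
Qed.

End PlanarLebesgue.

(** * The four-corner attractor *)

Section CornerAttractor.
Context {R : realType}.
Variables (r : R) (C : set (R * R)).
Hypotheses (r2 : 2 < r) (attrC : attractor (simil r) C).
Implicit Types (x y : R * R) (e : R) (i j : 'I_4).

Local Notation plane := (measurableTypeR R * measurableTypeR R)%type.

Let attr0 : C !=set0. Proof. by case: attrC. Qed.

Let attr_compact : compact C. Proof. by case: attrC. Qed.

Let attrE : C = \bigcup_(i in [set: 'I_4]) (simil r i @` C).
Proof. by case: attrC. Qed.

Let r0 : 0 < r. Proof. by rewrite (lt_trans _ r2). Qed.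

(** The supremum [m] of [f] over the attractor satisfies
[m <= m / r + (1 - 1 / r)], which forces [m <= 1]. The first hypothesis makes [m]
finite. Both coordinates and their reflections [1 - x.1], [1 - x.2] qualify, and
together they confine the attractor to the unit square. *)
Lemma attractor_coord_le (f : R * R -> R) (K : R) :
  (forall x, f x <= K * (1 + `|x|)) ->
  (forall i x, f (simil r i x) <= r^-1 * f x + (1 - r^-1)) ->
  forall x, C x -> f x <= 1.
Proof.
move=> fK fS.
have supC : has_sup (f @` C).
  split; first exact: image_nonempty.
  have [M [_ CM]] := compact_bounded attr_compact.
  exists (`|K| * (1 + (`|M| + 1))) => _ [x Cx <-].
  apply: (le_trans (fK x)).
  rewrite (le_trans (ler_wpM2r _ (ler_norm K)))// ?addr_ge0//.
  rewrite ler_wpM2l// lerD2l; apply: CM => //.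
  by rewrite (le_lt_trans (ler_norm M))// ltrDl.
have ri : r^-1 < 1 by rewrite invf_lt1// (lt_trans _ r2)// ltrDl.
have sup1 : sup (f @` C) <= 1.
  suff : sup (f @` C) <= r^-1 * sup (f @` C) + (1 - r^-1) by nra.
  apply: ge_sup; first exact: image_nonempty.
  move=> _ [x Cx <-]; move: Cx; rewrite {1}attrE => -[i _ [y Cy <-]].
  apply: (le_trans (fS i y)); rewrite lerD2r ler_wpM2l ?invr_ge0 ?(ltW r0)//.
  by apply: ub_le_sup; [exact: supC.2 | exists y].
move=> x Cx; apply: le_trans sup1.
by apply: ub_le_sup; [exact: supC.2|exists x].
Qed.

Let cornerP i :
  ((corner i).1 = 0 :> R \/ (corner i).1 = 1 :> R) /\
  ((corner i).2 = 0 :> R \/ (corner i).2 = 1 :> R).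
Proof.
by case: i => -[|[|[|[|i]]]]//= ?; rewrite /corner/=; split; (by left) || right.
Qed.

Let normE x : `|x| = Order.max `|x.1| `|x.2|. Proof. by []. Qed.

Lemma attractor_sub_square x : C x -> 0 <= x.1 <= 1 /\ 0 <= x.2 <= 1.
Proof.
move=> Cx.
have n1 y : `|y.1| <= `|y| by rewrite normE le_max lexx.
have n2 y : `|y.2| <= `|y| by rewrite normE le_max lexx orbT.
have rE : (r - 1) / r = 1 - r^-1 by field; rewrite gt_eqF.
have ri : 0 < 1 - r^-1.
  by rewrite subr_gt0 invf_lt1// (lt_trans _ r2)// ltrDl.
have x1 : x.1 <= 1.
  apply: (attractor_coord_le (f := fst) (K := 1)) => //.
    by move=> y; have := n1 y; have := ler_norm y.1; lra.
  by move=> i y; rewrite /= rE; have [[->|->] _] := cornerP i; nra.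
have x2 : x.2 <= 1.
  apply: (attractor_coord_le (f := snd) (K := 1)) => //.
    by move=> y; have := n2 y; have := ler_norm y.2; lra.
  by move=> i y; rewrite /= rE; have [_ [->|->]] := cornerP i; nra.
have x1' : 1 - x.1 <= 1.
  apply: (attractor_coord_le (f := fun y => 1 - y.1) (K := 1)) => //.
    by move=> y; have := n1 y; have := ler_norm (- y.1); rewrite normrN; lra.
  by move=> i y; rewrite /= rE; have [[->|->] _] := cornerP i; nra.
have x2' : 1 - x.2 <= 1.
  apply: (attractor_coord_le (f := fun y => 1 - y.2) (K := 1)) => //.
    by move=> y; have := n2 y; have := ler_norm (- y.2); rewrite normrN; lra.
  by move=> i y; rewrite /= rE; have [_ [->|->]] := cornerP i; nra.
by split; apply/andP; split; lra.
Qed.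

Lemma attractor_sub_disc : C `<=` disc (1 / 2, 1 / 2) (3 / 4).
Proof.
move=> x /attractor_sub_square[/andP[? ?] /andP[? ?]].
(* half the diagonal of the square is sqrt (1/2) < 3/4 *)
by rewrite /disc /= enorm_le /=; nra.
Qed.

(** Two distinct corners differ by 1 in some coordinate; there the two copies lie
in opposite strips of width [1 / r] of the unit square. *)
Lemma simil_separated i j x y : i != j -> C x -> C y ->
  1 - 2 / r <= enorm (simil r i x - simil r j y).
Proof.
move=> ij /attractor_sub_square[/andP[? ?] /andP[? ?]].
move=> /attractor_sub_square[/andP[? ?] /andP[? ?]].
have ri : 0 < r^-1 by rewrite invr_gt0.
have rE : (r - 1) / r = 1 - r^-1 by field; rewrite gt_eqF.
set p := simil r i x - simil r j y.
have [p1|[p1|[p1|p1]]] : 1 - 2 / r <= p.1 \/ 1 - 2 / r <= - p.1 \/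
    1 - 2 / r <= p.2 \/ 1 - 2 / r <= - p.2.
- rewrite /p /= rE; move: ij.
  case: i {p} => -[|[|[|[|i]]]]//= ?; case: j => -[|[|[|[|j]]]]//= ?;
    rewrite /corner//= => _; nra.
- by rewrite (le_trans p1)// (le_trans (ler_norm _))// coord1_le_enorm.
- by rewrite (le_trans p1)// (le_trans (ler_norm _))// normrN coord1_le_enorm.
- by rewrite (le_trans p1)// (le_trans (ler_norm _))// coord2_le_enorm.
- by rewrite (le_trans p1)// (le_trans (ler_norm _))// normrN coord2_le_enorm.
Qed.

Lemma trivIset_parallel_simil e : e < (1 - 2 / r) / 2 ->
  trivIset [set: 'I_4] (fun i => parallel_set (simil r i @` C) e).
Proof.
move=> er; have S0 i : simil r i @` C !=set0 by exact: image_nonempty.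
apply/trivIsetP => i j _ _ ij; apply/seteqP; split=> // x [].
move=> /(parallel_setP _ _ (S0 i)) /(_ _ er) [_ [a Ca <-] xa].
move=> /(parallel_setP _ _ (S0 j)) /(_ _ er) [_ [b Cb <-] xb].
have := simil_separated ij Ca Cb; apply/negP; rewrite -ltNge.
rewrite (le_lt_trans (enorm_triangle x _ _))// -(opprB x) enormN.
by lra.
Qed.

(** The affine map on the right is the inverse of the similarity, which dilates
Euclidean distances by [r]. *)
Lemma parallel_set_simil i e : parallel_set (simil r i @` C) e =
  affine r (- ((r - 1) * (corner i).1), - ((r - 1) * (corner i).2))
    @^-1` parallel_set C (r * e).
Proof.
set T := affine _ _.
have TE x a : enorm (T x - a) = r * enorm (x - simil r i a).
  by apply: enorm_homothety; rewrite ?(ltW r0)//= /T/=; field; rewrite gt_eqF.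
have S0 : simil r i @` C !=set0 by exact: image_nonempty.
apply/seteqP; split=> x.
  move=> /(parallel_setP _ _ S0) xS; apply/(parallel_setP _ _ attr0) => d ed.
  have [|_ [a Ca <-] xa] := xS (r^-1 * d).
    by rewrite mulrC ltr_pdivlMr// mulrC.
  by exists a => //; rewrite TE; move: xa; rewrite mulrC ltr_pdivlMr// mulrC.
move=> /(parallel_setP _ _ attr0) xS; apply/(parallel_setP _ _ S0) => d ed.
have [|a Ca] := xS (r * d); first by rewrite ltr_pM2l.
by rewrite TE ltr_pM2l// => xa; exists (simil r i a) => //; exists a.
Qed.

Lemma parallel_set_attractor e : parallel_set C e =
  \bigcup_(i in [set: 'I_4]) parallel_set (simil r i @` C) e.
Proof.
have S0 i : simil r i @` C !=set0 by exact: image_nonempty.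
apply/seteqP; split=> [x|x [i _]].
  by rewrite {1}attrE; apply: (parallel_set_bigcup ord0).
move=> /(parallel_setP _ _ (S0 i)) xS; apply/(parallel_setP _ _ attr0) => d ed.
have [_ [a Ca <-] xa] := xS _ ed; exists (simil r i a) => //.
by rewrite attrE; exists i => //; exists a.
Qed.

Lemma lebesgue2_parallel_lty e :
  0 <= e -> (lebesgue2 (parallel_set C e) < +oo)%E.
Proof.
move=> e0; pose D := disc (1 / 2 : R, 1 / 2 : R) (3 / 4 + e).
apply: (@le_lt_trans _ _ (lebesgue2 D)).
  apply: le_lebesgue2; [exact: measurable_parallel_set|exact: measurable_disc|].
  by apply: parallel_sub_disc => //; exact: attractor_sub_disc.
rewrite lebesgue2_disc; last lra.
by rewrite lte_mul_pinfty ?lee_fin ?sqr_ge0//; exact: lebesgue2_unit_disc_lty.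
Qed.

Lemma parallel_volumeE e : 0 <= e ->
  lebesgue2 (parallel_set C e) = (parallel_volume C e)%:E.
Proof.
move=> e0; rewrite /parallel_volume fineK//.
by rewrite ge0_fin_numE ?lebesgue2_parallel_lty.
Qed.

(** Four disjoint neighbourhoods, each an [r]-fold reduction of the
[(r * e)]-neighbourhood of the whole attractor. *)
Lemma parallel_volume_scale e : 0 <= e < (1 - 2 / r) / 2 ->
  parallel_volume C e = 4 / r ^+ 2 * parallel_volume C (r * e).
Proof.
move=> /andP[e0 er]; apply: EFin_inj; rewrite -parallel_volumeE//.
have re0 : 0 <= r * e by rewrite mulr_ge0// ltW.
pose F i : set plane := parallel_set (simil r i @` C) e.
have mF i : measurable (F i).
  by apply: measurable_parallel_set; exact: image_nonempty.
have -> : parallel_set C e = \big[setU/set0]_(i < 4) F i.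
  rewrite parallel_set_attractor -bigcup_seq; apply: eq_bigcupl.
  by split=> // i _ /=; rewrite mem_index_enum.
have := @measure_bigsetU_ord _ _ plane
  (@lebesgue_measure R \x @lebesgue_measure R)%E 4 xpredT F mF
  (trivIset_parallel_simil er).
rewrite -[LHS]/(lebesgue2 _) => ->.
rewrite (eq_bigr (fun=> ((r ^- 2 * parallel_volume C (r * e))%:E))).
  rewrite sumEFin big_const_ord iter_addr_0; congr EFin.
  by field; rewrite gt_eqF.
move=> i _; rewrite -[LHS]/(lebesgue2 _) /F parallel_set_simil.
rewrite lebesgue2_preimage_affine// ?parallel_volumeE//.
exact: measurable_parallel_set.
Qed.

Lemma disc_le_parallel_volume e : 0 < e ->
  e ^+ 2 * fine (lebesgue2 (@unit_disc R)) <= parallel_volume C e.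
Proof.
move=> e0; rewrite -lee_fin -parallel_volumeE ?(ltW e0)//.
have [c Cc] := attr0; rewrite -(fine_lebesgue2_disc c)//.
apply: le_lebesgue2; [exact: measurable_disc|exact: measurable_parallel_set|].
exact: disc_sub_parallel.
Qed.

Lemma parallel_volume_le_disc e : 0 < e ->
  parallel_volume C e <= (3 / 4 + e) ^+ 2 * fine (lebesgue2 (@unit_disc R)).
Proof.
move=> e0; rewrite -lee_fin -parallel_volumeE ?(ltW e0)//.
rewrite -(fine_lebesgue2_disc (1 / 2, 1 / 2)); last lra.
apply: le_lebesgue2; [exact: measurable_parallel_set|exact: measurable_disc|].
by apply: parallel_sub_disc => //; exact: attractor_sub_disc.
Qed.

End CornerAttractor.

(** * Consequences of a limit along a scaling law *)

Section ScalingLimit.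
Context {R : realType}.
Implicit Types (V : R -> R) (a k q r p b x M : R).

(** Shifting the index multiplies the sequence by [k] but keeps the limit, so
[k * M = M]. *)
Lemma cvg_geometric_neq0 a k M : a * k ^+ n @[n --> \oo] --> M -> M != 0 ->
  k = 1 /\ a = M.
Proof.
move=> aM M0.
have aSM : a * k ^+ n.+1 @[n --> \oo] --> M.
  by rewrite (cvg_shiftS (fun n => a * k ^+ n)).
have akM : a * k ^+ n.+1 @[n --> \oo] --> k * M.
  have -> : (fun n => a * k ^+ n.+1) = (fun n => k * (a * k ^+ n)).
    by apply/funext => n; rewrite exprS mulrCA.
  exact: cvgMr.
have k1 : k = 1.
  apply: (mulIf M0); rewrite mul1r; exact: cvg_unique akM aSM.
split=> //; move: aM; rewrite k1.
under eq_fun do rewrite expr1n mulr1.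
exact: cvg_unique (cvg_cst a).
Qed.

(** Along [x / r ^+ n] the quotient [V x / x `^ p] is geometric of ratio
[q * r `^ p]. Its first term is therefore already equal to the limit [M]. *)
Lemma power_law_of_scaling V q r p b M : 1 < r ->
  (forall x, 0 < x < b -> V x = q * V (r * x)) ->
  V x / x `^ p @[x --> 0^'+] --> M -> M != 0 ->
  forall x, 0 < x < r * b -> q * r `^ p = 1 /\ V x = M * x `^ p.
Proof.
move=> r1 Vq /cvg_at_rightP VM M0 x /andP[x0 xrb].
have r0 : 0 < r by rewrite (lt_trans _ r1).
pose u n := x * r^-1 ^+ n.
have u0 n : 0 < u n by rewrite mulr_gt0// exprn_gt0// invr_gt0.
have uS n : r * u n.+1 = u n.
  by rewrite /u exprS; field; rewrite gt_eqF.
have ucvg : u n @[n --> \oo] --> 0.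
  rewrite -[X in _ --> X](mulr0 x); apply: cvgMr.
  by apply: cvg_expr; rewrite gtr0_norm ?invr_gt0// invf_lt1.
have ulex n : u n <= x.
  by rewrite /u ger_pMr// exprn_ile1 ?invr_ge0 ?ltW// invf_lt1.
have rp0 : r `^ p != 0 by rewrite gt_eqF// powR_gt0.
have Vu n : V (u n) / u n `^ p = V x / x `^ p * (q * r `^ p) ^+ n.
  elim: n => [|n IHn]; first by rewrite /u expr0 !mulr1.
  have up0 : u n.+1 `^ p != 0 by rewrite gt_eqF// powR_gt0.
  rewrite exprSr mulrA -IHn -(uS n) powRM ?ltW// (Vq (u n.+1)).
    by field; rewrite rp0 up0.
  by rewrite u0 -(ltr_pM2l r0) uS (le_lt_trans (ulex n)).
have := VM u (conj u0 ucvg).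
under eq_fun do rewrite Vu.
move=> /cvg_geometric_neq0 /(_ M0)[-> <-]; split=> //.
by rewrite divfK// gt_eqF// powR_gt0.
Qed.

End ScalingLimit.

(** * Non-measurability *)

Theorem theorem4p1 (R : realType) (r : R) (C : set (R * R))
  (r30 : 30 <= r) (attrC : attractor (simil r) C) :
  ~ minkowski_measurable C.
Proof.
case=> -[M| |] [D _ CM] /andP[M0 Moo] //.
have r2 : 2 < r by lra.
have r0 : 0 < r by lra.
have VM : parallel_volume C e / e `^ (2 - D) @[e --> 0^'+] --> M.
  by move/fine_cvgP : CM => [].
have M_neq0 : M != 0 by rewrite gt_eqF// -lte_fin.
have scale e : 0 < e < (1 - 2 / r) / 2 ->
    parallel_volume C e = 4 / r ^+ 2 * parallel_volume C (r * e).
  by move=> /andP[e0 er]; apply: parallel_volume_scale; rewrite // ltW.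
have law := power_law_of_scaling (lt_trans (ltr1n _ 2) r2) scale VM M_neq0.
have rb : r * ((1 - 2 / r) / 2) = r / 2 - 1 by field; rewrite gt_eqF.
pose s := Num.sqrt r.
have ss : s * s = r by rewrite -expr2 sqr_sqrtr// ltW.
(* 27/5 is a rational lower bound for sqrt 30, large enough that
   2 * s < s ^+ 2 / 2 - 1, the end of the range of the power law *)
have s5 : 27 / 5 <= s.
  rewrite leNgt; apply/negP => s5.
  have s0 : 0 <= s by exact: sqrtr_ge0.
  nra.
have [rp V2] : 4 / r ^+ 2 * r `^ (2 - D) = 1 /\
    parallel_volume C 2 = M * 2 `^ (2 - D) by apply: law; rewrite rb; lra.
have [_ V2s] : 4 / r ^+ 2 * r `^ (2 - D) = 1 /\
    parallel_volume C (2 * s) = M * (2 * s) `^ (2 - D).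
  by apply: law; rewrite rb; apply/andP; split; nra.
(* r `^ (2 - D) = (r / 2) ^+ 2, and s is the square root of r *)
have sp : s `^ (2 - D) = r / 2.
  apply/eqP; rewrite -(@eqrXn2 _ 2) ?powR_ge0 ?divr_ge0 ?(ltW r0)//.
  rewrite expr2 -powRM ?sqrtr_ge0// ss; apply/eqP.
  apply: (@mulfI _ (4 / r ^+ 2)).
    by rewrite mulf_neq0// invr_neq0// sqrf_eq0 gt_eqF.
  by rewrite rp; field; rewrite gt_eqF.
have Vs : parallel_volume C (2 * s) = parallel_volume C 2 * (r / 2).
  by rewrite V2s V2 powRM ?sqrtr_ge0// sp mulrA.
pose u := fine (lebesgue2 (@unit_disc R)).
have u0 : 0 < u.
  by rewrite fine_gt0// lebesgue2_unit_disc_gt0 lebesgue2_unit_disc_lty.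
have V2_le : parallel_volume C 2 <= (3 / 4 + 2) ^+ 2 * u.
  by apply: (parallel_volume_le_disc r2 attrC); lra.
have V2s_ge : (2 * s) ^+ 2 * u <= parallel_volume C (2 * s).
  by apply: (disc_le_parallel_volume r2 attrC); lra.
have V2r : parallel_volume C 2 * (r / 2) <= (3 / 4 + 2) ^+ 2 * u * (r / 2).
  by rewrite ler_wpM2r// divr_ge0// ltW.
have ru : 0 < r * u by rewrite mulr_gt0.
have s2u : (2 * s) ^+ 2 * u = 4 * (r * u).
  by rewrite -ss; ring.
have u2r : (3 / 4 + 2) ^+ 2 * u * (r / 2) = 121 / 32 * (r * u) by field.
move: V2s_ge V2r; rewrite Vs s2u u2r.
move: (r * u) (parallel_volume C 2 * (r / 2)) ru => A B; lra.
Qed.
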